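(* Let $p$ be an odd prime, let $m\geq 3$ and $l$ be positive integers with $\gcd(m,l)=1$, $q=p^m$, and $\mathrm{Tr}$ the trace from $\mathbb{F}_q$ onto $\mathbb{F}_p$. Let $\mathcal{D}$ be either of the codes $$\mathcal{D}_1=\{(\mathrm{Tr}(ax^{p^l+1}+bx^2+cx)+h)_{x\in\mathbb{F}_q}: a,b,c\in\mathbb{F}_q, h\in\mathbb{F}_p\},\quad \mathcal{D}_2=\{(\mathrm{Tr}(ax^{p^l+1}+bx)+h)_{x\in\mathbb{F}_q}: a,b\in\mathbb{F}_q, h\in\mathbb{F}_p\},$$ with coordinates indexed by $\mathbb{F}_q$. Then for every $i>0$ such that $\mathcal{D}$ has a codeword of weight $i$ (i.e. $A_i\neq 0$), the supports of the codewords of weight $i$ in $\mathcal{D}$ form a $2$-design with point set $\mathbb{F}_q$.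
   Context: The support of a codeword $(c_x)_{x\in\mathbb{F}_q}$ is $\{x: c_x\neq 0\}$; $A_i$ is the number of codewords of Hamming weight $i$. A $t$-$(v,k,\lambda)$ design is a pair $(\mathcal{P},\mathcal{B})$ with $|\mathcal{P}|=v$, $\mathcal{B}$ a set of $k$-subsets (blocks) of $\mathcal{P}$, such that every $t$-subset of $\mathcal{P}$ is contained in exactly $\lambda$ blocks. In the paper $\mathcal{D}_1,\mathcal{D}_2$ are denoted $\overline{\mathcal{C}_1^{\perp}}^{\perp}$ and $\overline{\mathcal{C}_2^{\perp}}^{\perp}$. *)

(* Defs.v *)
From HB Require Import structures.
From mathcomp Require Import all_boot all_order all_fingroup all_algebra all_solvable all_field.

Set Implicit Arguments.
Unset Strict Implicit.
Unset Printing Implicit Defensive.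

Import GRing.Theory.
Local Open Scope ring_scope.

Section Codes.

Variables (p : nat) (F : finFieldType) (charFp : p \in [pchar F]).

(* The field F, seen as an extension of 'F_p. *)
Local Notation L := (pPrimeCharType charFp).

(* The trace from F onto 'F_p. The value of galTrace is an element of F lying
   in the prime subfield; Tr x is the corresponding element of 'F_p, and the
   default value 0 is never used (see TrE). *)
Definition Tr (x : F) : 'F_p :=
  odflt 0 [pick t : 'F_p | t%:A == galTrace 1 {:L} (x : L)].

Lemma TrE (x : F) : (Tr x)%:A = galTrace 1 {:L} (x : L) :> L.
Proof.
rewrite /Tr; case: pickP => [t /eqP //|no_t] /=.
have: galTrace 1 {:L} (x : L) \in 1%AS.
  by apply: mem_galTrace; [apply: finField_galois; apply: subvf | apply: memvf].
by case/vlineP=> t def_t; move: (no_t t); rewrite def_t eqxx.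
Qed.

Definition codeD1 (l : nat) : {set {ffun F -> 'F_p}} :=
  [set w | [exists a : F, exists b : F, exists c : F, exists h : 'F_p,
     w == [ffun x : F => Tr (a * x ^+ (p ^ l + 1) + b * x ^+ 2 + c * x) + h]]].

Definition codeD2 (l : nat) : {set {ffun F -> 'F_p}} :=
  [set w | [exists a : F, exists b : F, exists h : 'F_p,
     w == [ffun x : F => Tr (a * x ^+ (p ^ l + 1) + b * x) + h]]].

End Codes.

Section WeightsAndSupports.

Variables (I : finType) (K : nzRingType).

Definition supp (w : {ffun I -> K}) : {set I} := [set x | w x != 0].

Definition weight (w : {ffun I -> K}) : nat := #|supp w|.

End WeightsAndSupports.

Section WeightClasses.

Variables (I : finType) (K : finNzRingType) (C : {set {ffun I -> K}}).

Definition weight_class (i : nat) : {set {ffun I -> K}} :=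
  [set w in C | weight w == i].

(* A_i *)
Definition weight_count (i : nat) : nat := #|weight_class i|.

(* A set, not a multiset: codewords with the same support give one block. *)
Definition weight_supports (i : nat) : {set {set I}} :=
  [set supp w | w in weight_class i].

End WeightClasses.

(* (P, B) is a t-(v, k, lambda) design. *)
Definition is_design (T : finType) (t v k lambda : nat)
    (P : {set T}) (B : {set {set T}}) : Prop :=
  [/\ #|P| = v,
      forall b : {set T}, b \in B -> b \subset P /\ #|b| = k
    & forall S : {set T}, S \subset P -> #|S| = t ->
        #|[set b in B | S \subset b]| = lambda].

(* Main.v *)
Require Import Defs.
From HB Require Import structures.
From mathcomp Require Import all_boot all_order all_fingroup all_algebra all_solvable all_field.
From mathcomp Require Import ring.

(** Both codes are invariant under the affine substitutions [x -> u x + v]: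
    the only monomial outside the given shape that appears when expanding
    [(u x + v)^(p^l+1)] is [A x^(p^l)], and its trace is that of [C x] with
    [C^(p^l) = A].  The affine group acts doubly transitively on the field, so
    the number of blocks containing a pair of points does not depend on it. *)

Set Implicit Arguments.
Unset Strict Implicit.
Unset Printing Implicit Defensive.

Import GRing.Theory.
Local Open Scope ring_scope.

Section Trace.

Variables (p : nat) (F : finFieldType) (charFp : p \in [pchar F]).

Local Notation L := (pPrimeCharType charFp).
Local Notation Tr := (Tr charFp).

(** Scalars embed injectively in [L], so identities between values in ['F_p] can be checked in
    [L]. *)
Lemma Tr_eq (x : F) (t : 'F_p) :
  t%:A = galTrace 1 {:L} (x : L) :> L -> Tr x = t.
Proof. by rewrite -TrE => /(fmorph_inj (in_alg L)). Qed.

Lemma TrD (x y : F) : Tr (x + y) = Tr x + Tr y.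
Proof. by apply: Tr_eq; rewrite scalerDl !TrE -raddfD. Qed.

(** Frobenius commutes with each automorphism in the trace sum and fixes the prime field. *)
Lemma Tr_Frobenius (x : F) : Tr (x ^+ p) = Tr x.
Proof.
have p_pr := pcharf_prime charFp.
have charL : p \in [pchar L] := charFp.
(* [Tr x] lies in ['F_p], hence equals its own [p]-th power, which can be moved inside the sum. *)
apply: Tr_eq; rewrite -{1}[Tr x](expf_card (Tr x)) card_Fp //.
rewrite -[_%:A]/(in_alg L _) rmorphXn /= TrE /galTrace.
rewrite -(pFrobenius_autE charL) rmorph_sum.
by apply: eq_bigr => g _; rewrite /= pFrobenius_autE -rmorphXn.
Qed.

Lemma Tr_Frobenius_iter (l : nat) (x : F) : Tr (x ^+ (p ^ l)) = Tr x.
Proof.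
by elim: l => [|l IHl] /=; rewrite ?expr1 // expnSr exprM Tr_Frobenius.
Qed.

(** Frobenius is injective on a finite field, hence bijective; roots are extracted one at a time. *)
Lemma Frobenius_iter_surj (l : nat) (y : F) : exists z, z ^+ (p ^ l) = y.
Proof.
elim: l y => [|l IHl] y; first by exists y.
have [g _ gK] := injF_bij (fmorph_inj (pFrobenius_aut charFp)).
have [z def_z] := IHl (g y).
by exists z; rewrite expnSr exprM def_z -(pFrobenius_autE charFp) gK.
Qed.

Lemma Tr_affine_monomial (l : nat) (a u v : F) :
  exists c d : F, forall x, Tr (a * (u * x + v) ^+ (p ^ l + 1)) =
    Tr (a * u ^+ (p ^ l + 1) * x ^+ (p ^ l + 1) + c * x) + Tr d.
Proof.
(* The argument is the coefficient of [x ^+ (p ^ l)] in the expansion, so [e * x] has the same trace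
   as that term. *)
have [e def_e] := Frobenius_iter_surj l (a * u ^+ (p ^ l) * v).
exists (e + a * v ^+ (p ^ l) * u), (a * v ^+ (p ^ l + 1)) => x.
have frobD (y z : F) : (y + z) ^+ (p ^ l) = y ^+ (p ^ l) + z ^+ (p ^ l).
  apply: exprDn_pchar; rewrite (eq_pnat _ (pcharf_eq charFp)) pnatX.
  by rewrite pnat_id ?(pcharf_prime charFp).
rewrite mulrDl !TrD -(Tr_Frobenius_iter l (e * x)) exprMn def_e -!TrD.
by congr (Tr _); rewrite !addn1 !exprSr frobD exprMn; ring.
Qed.

Lemma codeD1_affine (l : nat) (u v : F) (w : {ffun F -> 'F_p}) :
  w \in codeD1 charFp l -> [ffun x => w (u * x + v)] \in codeD1 charFp l.
Proof.
rewrite !inE => /existsP[a /existsP[b /existsP[c /existsP[h /eqP->]]]].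
have [e [d def_a]] := Tr_affine_monomial l a u v.
apply/existsP; exists (a * u ^+ (p ^ l + 1)).
apply/existsP; exists (b * u ^+ 2).
(* The cross term of [b * (u * x + v) ^+ 2] joins the linear part; the traces of all constants are
   absorbed into [h]. *)
apply/existsP; exists (e + b * (u * v) *+ 2 + c * u).
apply/existsP; exists (Tr (d + b * v ^+ 2 + c * v) + h).
apply/eqP/ffunP=> x; rewrite !ffunE addrA; congr (_ + _).
by rewrite -[X in Tr X = _]addrA [LHS]TrD def_a -!TrD; congr (Tr _); ring.
Qed.

Lemma codeD2_affine (l : nat) (u v : F) (w : {ffun F -> 'F_p}) :
  w \in codeD2 charFp l -> [ffun x => w (u * x + v)] \in codeD2 charFp l.
Proof.
rewrite !inE => /existsP[a /existsP[b /existsP[h /eqP->]]].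
have [e [d def_a]] := Tr_affine_monomial l a u v.
apply/existsP; exists (a * u ^+ (p ^ l + 1)).
apply/existsP; exists (e + b * u).
apply/existsP; exists (Tr (d + b * v) + h).
apply/eqP/ffunP=> x; rewrite !ffunE addrA; congr (_ + _).
by rewrite [LHS]TrD def_a -!TrD; congr (Tr _); ring.
Qed.

End Trace.

Section Designs.

Variable T : finType.

(** Preimage under [f] injects the blocks containing [S2] into those containing [S1]; exchanging the
    two sets gives equal counts. *)
Lemma homogeneous_design (t k : nat) (B : {set {set T}}) :
    (forall b, b \in B -> #|b| = k) ->
    (forall S1 S2 : {set T}, #|S1| = t -> #|S2| = t ->
      exists f : T -> T, [/\ injective f, f @: S1 = S2 &
        forall b, b \in B -> f @^-1: b \in B]) ->
  exists lambda, is_design t #|T| k lambda [set: T] B.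
Proof.
move=> cardB homB; pose N (S : {set T}) := #|[set b in B | S \subset b]|.
have leN (S1 S2 : {set T}) : #|S1| = t -> #|S2| = t -> (N S2 <= N S1)%N.
  move=> tS1 tS2; have [f [injf <- fB]] := homB _ _ tS1 tS2.
  have [g fK gK] := injF_bij injf.
  have inj_pre : injective (fun b : {set T} => f @^-1: b).
    by move=> b1 b2 /setP eqb; apply/setP=> x; have := eqb (g x); rewrite !inE gK.
  rewrite /N -[leqLHS](card_imset _ inj_pre).
  apply/subset_leq_card/subsetP=> _ /imsetP[b + ->].
  by rewrite !inE => /andP[Bb Sb]; rewrite fB // -sub_imset_pre.
have [/existsP[S0 /eqP tS0] | noS] := boolP [exists S : {set T}, #|S| == t].
  exists (N S0); split=> [|b Bb|S _ tS]; rewrite ?cardsT ?cardB ?subsetT //.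
  by apply/eqP; rewrite eqn_leq !leN.
(* Without any [t]-subset the last condition is vacuous, and any value would do. *)
exists 0%N; split=> [|b Bb|S _ tS]; rewrite ?cardsT ?cardB ?subsetT //.
by case/existsP: noS; exists S; apply/eqP.
Qed.

(** Composing a codeword with [f] replaces its support by the preimage, of the same size since [f]
    is a bijection of a finite set. *)
Lemma weight_supports_preim (K : finNzRingType) (C : {set {ffun T -> K}})
    (f : T -> T) (i : nat) : injective f ->
    (forall w, w \in C -> [ffun x => w (f x)] \in C) ->
  forall b, b \in weight_supports C i -> f @^-1: b \in weight_supports C i.
Proof.
move=> injf fC _ /imsetP[w + ->]; rewrite inE => /andP[Cw /eqP wt_w].
have def_supp : supp [ffun x => w (f x)] = f @^-1: supp w.
  by apply/setP=> x; rewrite !inE ffunE.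
apply/imsetP; exists [ffun x => w (f x)] => //.
by rewrite inE fC //= -wt_w /weight def_supp card_preimset.
Qed.

End Designs.

Lemma affine_2homogeneous (F : finFieldType) (S1 S2 : {set F}) :
    #|S1| = 2%N -> #|S2| = 2%N ->
  exists u v : F, injective (fun x => u * x + v) /\
    (fun x => u * x + v) @: S1 = S2.
Proof.
move=> /eqP/cards2P[a [b [nz_ab ->]]] /eqP/cards2P[c [d [nz_cd ->]]].
have nz_ba : b - a != 0 by rewrite subr_eq0 eq_sym.
have nz_dc : d - c != 0 by rewrite subr_eq0 eq_sym.
(* Slope of the line through [(a, c)] and [(b, d)], nonzero as [c] and [d] differ; [v] is then
   forced by sending [a] to [c]. *)
pose u := (d - c) / (b - a).
have nz_u : u != 0 by rewrite mulf_neq0 ?invr_neq0.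
exists u, (c - u * a); split=> [x y /addIr/(mulfI nz_u) //|].
rewrite imsetU1 imset_set1 addrC subrK; congr [set _; _].
by rewrite addrCA -mulrBr divfK // addrC subrK.
Qed.

Local Close Scope ring_scope.

Theorem theorem4p2 (p m l : nat) (F : finFieldType)
    (p_prime : prime p) (p_odd : odd p) (m_ge3 : 3 <= m) (l_gt0 : 0 < l)
    (coprime_ml : gcdn m l = 1) (cardF : #|F| = p ^ m)
    (D : {set {ffun F -> 'F_p}})
    (defD : D = codeD1 (card_finPcharP cardF p_prime) l \/
            D = codeD2 (card_finPcharP cardF p_prime) l)
    (i : nat) (i_gt0 : 0 < i) (Ai_neq0 : weight_count D i <> 0) :
  exists lambda : nat,
    is_design 2 (p ^ m) i lambda [set: F] (weight_supports D i).
Proof.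
rewrite -cardF; apply: homogeneous_design => [b | S1 S2 S1_2 S2_2].
  by case/imsetP=> w + ->; rewrite inE => /andP[_ /eqP].
have [u [v [inj_uv defS2]]] := affine_2homogeneous S1_2 S2_2.
(* It remains to see that the code is stable under this substitution. *)
exists (fun x => u * x + v)%R; split=> //; apply: weight_supports_preim => // w.
by case: defD => ->; [apply: codeD1_affine | apply: codeD2_affine].
Qed.
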